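(* Let $\mathcal A$ be a $C^*$-algebra with identity $1$ and $\delta\colon\mathcal A\to\mathcal A$ a $^*$-endomorphism. The following are equivalent: 1) there exists a complete transfer operator $\delta_*$ for $(\mathcal A,\delta)$; 2) (i) there exists a non-degenerate transfer operator $\delta_*$ for $(\mathcal A,\delta)$, and (ii) $\delta(\mathcal A)$ is a hereditary subalgebra of $\mathcal A$; 3) (i) there exists a central orthogonal projection $P\in\mathcal A$ such that (a) $\delta(P)=\delta(1)$ and (b) the restriction $\delta\colon P\mathcal A\to\delta(\mathcal A)$ is a $^*$-isomorphism; and (ii) $\delta(\mathcal A)=\delta(1)\mathcal A\delta(1)$. Moreover, the transfer operator $\delta_*$ in 1) and in 2) is unique, the projection $P$ in 3) is unique, $P=\delta_*(1)$, and $\delta_*(a)=\delta^{-1}(\delta(1)a\delta(1))$ for all $a\in\mathcal A$, where $\delta^{-1}\colon\delta(\mathcal A)\to P\mathcal A$ is the inverse of the $^*$-isomorphism $\delta\colon P\mathcal A\to\delta(\mathcal A)$.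
   Context: A transfer operator for $(\mathcal A,\delta)$ is a continuous positive linear map $\delta_*\colon\mathcal A\to\mathcal A$ such that $\delta_*(\delta(a)b)=a\,\delta_*(b)$ for all $a,b\in\mathcal A$. It is non-degenerate if $\delta(\delta_*(1))=\delta(1)$ (equivalently $\delta\circ\delta_*\circ\delta=\delta$). It is complete if $\delta(\delta_*(a))=\delta(1)a\delta(1)$ for all $a\in\mathcal A$. *)

(* Defs.v *)
From mathcomp Require Import all_boot all_algebra.
From mathcomp Require Import reals complex.
Import GRing.Theory Num.Theory.
Set Implicit Arguments. Unset Strict Implicit. Unset Printing Implicit Defensive.
Local Open Scope ring_scope.
Local Open Scope complex_scope.

Record is_cstar (R : realType) (A : algType R[i]) (star : A -> A) (nrm : A -> R)
  : Prop := IsCstar {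
  star_add : forall a b, star (a + b) = star a + star b;
  star_scale : forall (c : R[i]) a, star (c *: a) = c^* *: star a;
  star_mul : forall a b, star (a * b) = star b * star a;
  star_invol : forall a, star (star a) = a;
  nrm_ge0 : forall a, 0 <= nrm a;
  nrm_eq0 : forall a, nrm a = 0 -> a = 0;
  nrm_triangle : forall a b, nrm (a + b) <= nrm a + nrm b;
  nrm_scale : forall (c : R[i]) a, (nrm (c *: a))%:C = `|c| * (nrm a)%:C;
  nrm_submul : forall a b, nrm (a * b) <= nrm a * nrm b;
  nrm_cstar : forall a, nrm (star a * a) = nrm a ^+ 2;
  nrm_complete : forall u : nat -> A,
    (forall e : R, 0 < e -> exists N, forall m n, (N <= m)%N -> (N <= n)%N ->
        nrm (u m - u n) < e) ->
    exists l : A, forall e : R, 0 < e -> exists N, forall n, (N <= n)%N ->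
        nrm (u n - l) < e
}.

Section Defs.
Variables (R : realType) (A : algType R[i]) (star : A -> A) (nrm : A -> R).

Definition positive (a : A) : Prop := exists b, a = star b * b.

Definition ncontinuous (f : A -> A) : Prop :=
  forall (x : A) (e : R), 0 < e -> exists2 d : R, 0 < d &
    forall y, nrm (y - x) < d -> nrm (f y - f x) < e.

Definition is_linear (f : A -> A) : Prop :=
  (forall a b, f (a + b) = f a + f b) /\ (forall (c : R[i]) a, f (c *: a) = c *: f a).

Definition star_endo (d : A -> A) : Prop :=
  [/\ is_linear d, (forall a b, d (a * b) = d a * d b) &
      (forall a, d (star a) = star (d a))].

Definition transfer_operator (d T : A -> A) : Prop :=
  [/\ ncontinuous T, is_linear T, (forall a, positive a -> positive (T a)) &
      (forall a b, T (d a * b) = a * T b)].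

Definition nondegenerate_transfer (d T : A -> A) : Prop :=
  transfer_operator d T /\ d (T 1) = d 1.

Definition complete_transfer (d T : A -> A) : Prop :=
  transfer_operator d T /\ (forall a, d (T a) = d 1 * a * d 1).

Definition in_range (d : A -> A) (x : A) : Prop := exists a, x = d a.

Definition hereditary_subalgebra (S : A -> Prop) : Prop :=
  [/\ S 0, (forall a b, S a -> S b -> S (a + b)),
      (forall (c : R[i]) a, S a -> S (c *: a)),
      (forall a b, S a -> S b -> S (a * b)) &
      (forall a, S a -> S (star a))] /\
  (forall (u : nat -> A) (l : A), (forall n, S (u n)) ->
     (forall e : R, 0 < e -> exists N, forall n, (N <= n)%N -> nrm (u n - l) < e) ->
     S l) /\
  (forall a b, positive a -> positive (b - a) -> S b -> S a).

Definition central_projection (P : A) : Prop :=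
  [/\ P * P = P, star P = P & forall a, P * a = a * P].

Definition in_corner (P x : A) : Prop := exists a, x = P * a.

(* d restricted to P A is a *-isomorphism onto d(A) (d is already a
   *-homomorphism, so this means bijectivity of d : P A -> d(A)) *)
Definition restr_iso (d : A -> A) (P : A) : Prop :=
  (forall x y, in_corner P x -> in_corner P y -> d x = d y -> x = y) /\
  (forall a, exists2 x, in_corner P x & d x = d a).

Definition cond3i (d : A -> A) (P : A) : Prop :=
  [/\ central_projection P, d P = d 1 & restr_iso d P].

Definition range_corner (d : A -> A) : Prop :=
  forall x, in_range d x <-> exists a, x = d 1 * a * d 1.

End Defs.

(* Main.v *)
(* The operator-algebraic input is that [a = star b * b] is a proper cone (Fukamiya, Kaplansky)
   and that a positive linear map is bounded; both rest on square roots of [1 - k] with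
   [nrm k <= 1], obtained as limits of s |-> (k + s^2) / 2.  Properness makes the corner
   [d 1 * A * d 1] hereditary.  Conversely a hereditary range contains the corner, because
   d(1) a d(1) <= ||a|| d(1) for positive [a], and on the corner a non-degenerate [T]
   inverts [d] on the ideal cut out by the central projection [T 1].  From a projection [P]
   one takes for [T a] the preimage of d(1) a d(1) in [P A]; it is positive because [d] is
   injective on [P A] and thus kills no negative part. *)

Require Import Defs.
From mathcomp Require Import all_boot all_order all_algebra.
From mathcomp Require Import boolp reals complex.
From mathcomp Require Import ring lra.
Import Order.TTheory GRing.Theory Num.Theory.
Set Implicit Arguments. Unset Strict Implicit. Unset Printing Implicit Defensive.
Local Open Scope ring_scope.
Local Open Scope complex_scope.

Section CstarAlgebra.
Variables (R : realType) (A : algType R[i]) (star : A -> A) (nrm : A -> R).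
Hypothesis hA : is_cstar star nrm.

Let starD := star_add hA.
Let starZ := star_scale hA.
Let starM := star_mul hA.
Let starK := star_invol hA.
Let nge0 := nrm_ge0 hA.
Let nrmD := nrm_triangle hA.
Let nrmM := nrm_submul hA.
Let nrmC := nrm_cstar hA.
Let nrm0_eq0 := nrm_eq0 hA.

(** * Elementary identities for the involution and the norm *)

Lemma star0 : star 0 = 0.
Proof. by rewrite -(scale0r (0 : A)) starZ rmorph0 !scale0r. Qed.

Lemma starN a : star (- a) = - star a.
Proof. by apply/eqP; rewrite -subr_eq0 opprK -starD addNr star0. Qed.

Lemma starB a b : star (a - b) = star a - star b.
Proof. by rewrite starD starN. Qed.

Lemma star1 : star 1 = 1.
Proof. by rewrite -[LHS]mulr1 -{2}(starK 1) -starM mulr1 starK. Qed.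

Lemma starZr (r : R) a : star (r%:C *: a) = r%:C *: star a.
Proof. by rewrite starZ; congr (_ *: _); exact: conjc_real. Qed.

Lemma starZi a : star ('i%C *: a) = - ('i%C *: star a).
Proof.
rewrite starZ -scaleNr; congr (_ *: _).
by apply/eqP; rewrite eq_complex /= oppr0 !eqxx.
Qed.

Lemma scale_ii (a : A) : 'i%C *: ('i%C *: a) = - a.
Proof. by rewrite scalerA -expr2 sqr_i scaleN1r. Qed.

Lemma half_double (a : A) : (2^-1 : R)%:C *: (a + a) = a.
Proof.
rewrite scalerDr -scalerDl -rmorphD (_ : 2^-1 + 2^-1 = 1 :> R); last by lra.
by rewrite rmorph1 scale1r.
Qed.

Lemma nrmZr (r : R) a : nrm (r%:C *: a) = `|r| * nrm a.
Proof.
by apply: complexI; rewrite (nrm_scale hA) normc_def /= expr0n addr0 sqrtr_sqr rmorphM.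
Qed.

Lemma nrmZi a : nrm ('i%C *: a) = nrm a.
Proof.
by apply: complexI; rewrite (nrm_scale hA) normc_def /= expr0n expr1n add0r sqrtr1 mul1r.
Qed.

Lemma nrm0 : nrm 0 = 0.
Proof. by have := nrmZr 0 0; rewrite rmorph0 scale0r normr0 mul0r. Qed.

Lemma nrmN a : nrm (- a) = nrm a.
Proof. by have := nrmZr (-1) a; rewrite rmorphN1 scaleN1r normrN1 mul1r. Qed.

Lemma nrm_sub a b : nrm (a - b) <= nrm a + nrm b.
Proof. by rewrite -(nrmN b); exact: nrmD. Qed.

Lemma nrm_star_le a : nrm a <= nrm (star a).
Proof.
have [->|/eqP a0] := eqVneq a 0; first by rewrite star0.
have na : 0 < nrm a.
  by rewrite lt_neqAle nge0 andbT eq_sym; apply/eqP => /nrm0_eq0.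
by rewrite -(ler_pM2r na) -expr2 -nrmC nrmM.
Qed.

Lemma nrm_star a : nrm (star a) = nrm a.
Proof. by apply/eqP; rewrite eq_le nrm_star_le -{2}(starK a) nrm_star_le. Qed.

Lemma nrm_sq a : star a = a -> nrm (a * a) = nrm a ^+ 2.
Proof. by move=> {1}<-; rewrite nrmC. Qed.

Lemma cstar_eq0 a : star a * a = 0 -> a = 0.
Proof.
move=> h; apply/nrm0_eq0/eqP.
by rewrite -sqrf_eq0 -nrmC h nrm0.
Qed.

Lemma sa_sq_eq0 a : star a = a -> a * a = 0 -> a = 0.
Proof. by move=> h; rewrite -{1}h => /cstar_eq0. Qed.

Lemma nrm1_le : nrm 1 <= 1.
Proof.
have : nrm 1 * nrm 1 = nrm 1 by rewrite -expr2 -nrm_sq ?mulr1 ?star1.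
have [->//|h] := eqVneq (nrm 1) 0.
by rewrite -[X in _ = X -> _]mulr1 => /(mulfI h) ->.
Qed.

(** * Limits in norm *)

Definition nlim (u : nat -> A) (l : A) := forall e : R, 0 < e ->
  exists N, forall n, (N <= n)%N -> nrm (u n - l) < e.

Lemma nlim_unique u l m : nlim u l -> nlim u m -> l = m.
Proof.
move=> ul um; apply/eqP; rewrite -subr_eq0; apply/eqP/nrm0_eq0/eqP.
rewrite eq_le nge0 andbT; apply/ler_addgt0Pl => e e0; rewrite addr0.
have e2 : 0 < e / 2 by rewrite divr_gt0.
have [N hN] := ul _ e2; have [M hM] := um _ e2.
have := hN _ (leq_maxl N M); have := hM _ (leq_maxr N M).
set n := maxn N M => h1 h2.
have := nrm_sub (u n - m) (u n - l).
by rewrite opprB addrC subrKA; lra.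
Qed.

Lemma nlimD u v l m : nlim u l -> nlim v m -> nlim (fun n => u n + v n) (l + m).
Proof.
move=> ul vm e e0; have e2 : 0 < e / 2 by rewrite divr_gt0.
have [N hN] := ul _ e2; have [M hM] := vm _ e2.
exists (maxn N M) => n; rewrite geq_max => /andP[/hN h1 /hM h2].
rewrite opprD addrACA; have := nrmD (u n - l) (v n - m); lra.
Qed.

Lemma nlim_lip (f : A -> A) (C : R) u l :
  (forall a b, nrm (f a - f b) <= C * nrm (a - b)) ->
  nlim u l -> nlim (fun n => f (u n)) (f l).
Proof.
move=> hf ul e e0.
have C0 : 0 < `|C| + 1 by have := normr_ge0 C; lra.
have [N hN] := ul _ (divr_gt0 e0 C0).
exists N => n /hN; rewrite ltr_pdivlMr // => h; apply: le_lt_trans h.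
apply: (le_trans (hf _ _)); rewrite mulrC; apply: ler_wpM2l; first exact: nge0.
have := ler_norm C; lra.
Qed.

Lemma nlimMl a u l : nlim u l -> nlim (fun n => a * u n) (a * l).
Proof. by apply: (@nlim_lip _ (nrm a)) => x y; rewrite -mulrBr nrmM. Qed.

Lemma nlimMr a u l : nlim u l -> nlim (fun n => u n * a) (l * a).
Proof.
by apply: (@nlim_lip (fun x => x * a) (nrm a)) => x y; rewrite -mulrBl mulrC nrmM.
Qed.

Lemma nlimZ (r : R) u l : nlim u l -> nlim (fun n => r%:C *: u n) (r%:C *: l).
Proof. by apply: (@nlim_lip _ `|r|) => x y; rewrite -scalerBr nrmZr. Qed.

Lemma nlim_star u l : nlim u l -> nlim (fun n => star (u n)) (star l).
Proof. by apply: (@nlim_lip _ 1) => x y; rewrite -starB nrm_star mul1r. Qed.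

Lemma nlim_cst a : nlim (fun=> a) a.
Proof. by move=> e e0; exists 0%N => n _; rewrite subrr nrm0. Qed.

Lemma nlimS u l : nlim u l -> nlim (fun n => u n.+1) l.
Proof. by move=> ul e /ul[N hN]; exists N => n h; apply: hN; exact: leqW. Qed.

(** Split [u n * u n] as [u n * (u n - l) + u n * l]; the uniform bound on [u n] sends the first
    term to 0. *)
Lemma nlim_sq u l : (forall n, nrm (u n) <= 1) -> nlim u l ->
  nlim (fun n => u n * u n) (l * l).
Proof.
move=> u1 ul.
have h : nlim (fun n => u n * (u n - l)) 0.
  move=> e e0; have [N hN] := ul _ e0; exists N => n /hN; apply: le_lt_trans.
  rewrite subr0; apply: (le_trans (nrmM _ _)).
  by rewrite -[leRHS]mul1r ler_wpM2r // nge0.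
have := nlimD h (nlimMr l ul); rewrite add0r.
by under eq_fun do rewrite mulrBr subrK.
Qed.

(** * Square roots of [1 - k] by iteration *)

Fixpoint sqrt_iter (k : A) (n : nat) : A :=
  if n is n'.+1 then (2^-1 : R)%:C *: (k + sqrt_iter k n' * sqrt_iter k n') else 0.

(* the scalar sequence [sqrt_iter 1] dominates [sqrt_iter k] when [nrm k <= 1] *)
Fixpoint sqrt_bound (n : nat) : R :=
  if n is n'.+1 then (1 + sqrt_bound n' ^+ 2) / 2 else 0.

Lemma sqrt_bound_ge0 n : 0 <= sqrt_bound n.
Proof. by case: n => //= n; rewrite divr_ge0 // addr_ge0 // sqr_ge0. Qed.

Lemma sqrt_bound_le1 n : sqrt_bound n <= 1.
Proof.
elim: n => //= n ih; rewrite ler_pdivrMr // mul1r.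
by have := exprn_ile1 2 (sqrt_bound_ge0 n) ih; lra.
Qed.

(** The defect [x = 1 - sqrt_bound n] evolves by [x |-> x * (1 - x / 2)], hence decays like 2/n; the
    estimate is an equality at [n = 0]. *)
Lemma sqrt_bound_rate n : (1 - sqrt_bound n) * n.+2%:R <= 2.
Proof.
elim: n => [|n ih]; first by rewrite /= subr0 mul1r.
set x := 1 - sqrt_bound n in ih; set N : R := n.+2%:R in ih.
have -> : (1 - sqrt_bound n.+1) * n.+3%:R = x * (1 - x / 2) * (N + 1).
  by rewrite /= /x /N -(natr1 n.+2); field.
have N2 : 2 <= N by rewrite /N ler_nat.
have xle : x <= 1 by have := sqrt_bound_ge0 n; rewrite /x; lra.
have N0 : 0 < N ^+ 2 by rewrite exprn_gt0 //; lra.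
rewrite -(ler_pM2r N0) -subr_ge0.
(* After scaling by [N ^+ 2] the slack is a sum of nonnegative terms: [x * N <= 2] is the induction
   hypothesis, and with [2 <= N] it also makes [N - 1 - x * N / 2] nonnegative. *)
have -> : 2 * N ^+ 2 - x * (1 - x / 2) * (N + 1) * N ^+ 2 =
  2 + (2 - x * N) * (N - 1 - x * N / 2) * (N + 1) by field.
by rewrite addr_ge0 // mulr_ge0 ?mulr_ge0 //; lra.
Qed.

Lemma comm_sqrt_iter b k n : b * k = k * b -> b * sqrt_iter k n = sqrt_iter k n * b.
Proof.
move=> bk; elim: n => /= [|n ih]; first by rewrite mulr0 mul0r.
by rewrite -scalerAr -scalerAl mulrDr mulrDl bk mulrA ih -mulrA ih mulrA.
Qed.

Lemma star_sqrt_iter k n : star k = k -> star (sqrt_iter k n) = sqrt_iter k n.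
Proof.
by move=> sk; elim: n => /= [|n ih]; rewrite ?star0 // starZr starD starM ih sk.
Qed.

Lemma nrm_sqrt_iter k n : nrm k <= 1 -> nrm (sqrt_iter k n) <= sqrt_bound n.
Proof.
move=> k1; elim: n => /= [|n ih]; first by rewrite nrm0.
rewrite nrmZr ger0_norm ?invr_ge0 // [leRHS]mulrC ler_wpM2l ?invr_ge0 //.
apply: le_trans (nrmD _ _) _; apply: lerD => //.
apply: le_trans (nrmM _ _) _; rewrite expr2; exact: ler_pM.
Qed.

(** A difference of squares is [s' * (s' - s) + (s' - s) * s] without any commutativity, and the
    scalar sequence obeys the same identity, so domination passes from one increment to the next. *)
Lemma nrm_sqrt_iterS k n : nrm k <= 1 ->
  nrm (sqrt_iter k n.+1 - sqrt_iter k n) <= sqrt_bound n.+1 - sqrt_bound n.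
Proof.
move=> k1; elim: n => [|n ih].
  by have := nrm_sqrt_iter 1 k1; rewrite !subr0.
set s := sqrt_iter k in ih *; set t := sqrt_bound in ih *.
have -> : s n.+2 - s n.+1 =
    (2^-1 : R)%:C *: (s n.+1 * (s n.+1 - s n) + (s n.+1 - s n) * s n).
  have sS m : s m.+1 = (2^-1 : R)%:C *: (k + s m * s m) by [].
  rewrite {1}sS {2}sS -scalerBr opprD addrACA subrr add0r.
  by rewrite mulrBr mulrBl subrKA.
have -> : t n.+2 - t n.+1 = 2^-1 * (t n.+1 * (t n.+1 - t n) + (t n.+1 - t n) * t n).
  have tS m : t m.+1 = (1 + t m ^+ 2) / 2 by [].
  by rewrite {1}tS {2}tS; field.
rewrite nrmZr ger0_norm ?invr_ge0 // ler_wpM2l ?invr_ge0 //.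
apply: le_trans (nrmD _ _) _; apply: lerD; apply: le_trans (nrmM _ _) _;
  by apply: ler_pM => //; exact: nrm_sqrt_iter.
Qed.

Lemma nrm_sqrt_iterB k m n : nrm k <= 1 -> (n <= m)%N ->
  nrm (sqrt_iter k m - sqrt_iter k n) <= 1 - sqrt_bound n.
Proof.
move=> k1 /subnK <-.
suff h : nrm (sqrt_iter k (m - n + n) - sqrt_iter k n) <= sqrt_bound (m - n + n) - sqrt_bound n.
  by have := sqrt_bound_le1 (m - n + n); lra.
elim: (m - n)%N => [|j ih]; first by rewrite !subrr nrm0.
have := nrmD (sqrt_iter k (j + n).+1 - sqrt_iter k (j + n)) (sqrt_iter k (j + n) - sqrt_iter k n).
have := nrm_sqrt_iterS (j + n) k1.
by rewrite subrKA addSn; lra.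
Qed.

Lemma sqrt_bound_near1 (e : R) : 0 < e -> exists N, 1 - sqrt_bound N < e.
Proof.
move=> e0; have e2 : 0 <= 2 / e by rewrite divr_ge0 // ltW.
have := archi_boundP e2; set N := Num.bound _ => hN.
exists N; rewrite -(@ltr_pM2r _ N.+2%:R) ?ltr0n //.
apply: le_lt_trans (sqrt_bound_rate N) _.
rewrite mulrC -ltr_pdivrMr //; apply: lt_le_trans hN _.
by rewrite ler_nat; apply: leqW.
Qed.

Definition bicomm (a c : A) := forall b, b * a = a * b -> b * c = c * b.

(** The limit satisfies [s = (k + s * s) / 2], that is [(1 - s) * (1 - s) = 1 - k]. The bound on
    [1 - c] allows the lemma to be applied again, to [1 - c]. *)
Lemma sqrt_1sub k : star k = k -> nrm k <= 1 ->
  exists c, [/\ star c = c, c * c = 1 - k, bicomm k c & nrm (1 - c) <= 1].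
Proof.
move=> sk k1; have [|s hs] := nrm_complete hA (u := sqrt_iter k).
  move=> e e0; have [N hN] := sqrt_bound_near1 (divr_gt0 e0 (ltr0n _ 2)).
  exists N => m n mN nN.
  have := nrm_sqrt_iterB k1 mN; have := nrm_sqrt_iterB k1 nN.
  have := nrm_sub (sqrt_iter k m - sqrt_iter k N) (sqrt_iter k n - sqrt_iter k N).
  by rewrite opprB subrKA; lra.
have ss : star s = s.
  apply: (nlim_unique _ hs); have := nlim_star hs.
  by under eq_fun do rewrite star_sqrt_iter //.
have cs b : b * k = k * b -> b * s = s * b.
  move=> bk; apply: (nlim_unique (nlimMl b hs)); have := nlimMr b hs.
  by under eq_fun do rewrite -comm_sqrt_iter //.
have fs : s = (2^-1 : R)%:C *: (k + s * s).
  apply: (nlim_unique (nlimS hs)) => /=; apply/nlimZ/nlimD; first exact: nlim_cst.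
  apply: nlim_sq => // n; apply: le_trans (sqrt_bound_le1 n); exact: nrm_sqrt_iter.
have ks : s * s = s + s - k.
  suff -> : s + s = k + s * s by rewrite addrC addKr.
  by rewrite {1 2}fs -scalerDr half_double.
exists (1 - s); split.
- by rewrite starB star1 ss.
- rewrite mulrBr mulr1 mulrBl mul1r ks opprB.
  by rewrite (addrAC (s + s)) addrK subrKA.
- by move=> b /cs h; rewrite mulrBl mulrBr mulr1 mul1r h.
- rewrite subKr; apply/ler_addgt0Pl => e e0; have [N hN] := hs _ e0.
  have := nrm_sub (sqrt_iter k N) (sqrt_iter k N - s); rewrite subKr.
  have := hN _ (leqnn N); have := nrm_sqrt_iter N k1; have := sqrt_bound_le1 N; lra.
Qed.

(** * The cone of squares of self-adjoint elements *)

Local Notation sc r := ((r : R)%:C *: (1 : A)).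

Lemma star_sc r : star (sc r) = sc r.
Proof. by rewrite starZr star1. Qed.

Lemma scD r s : sc (r + s) = sc r + sc s.
Proof. by rewrite rmorphD scalerDl. Qed.

Lemma sc_comm r a : a * sc r = sc r * a.
Proof. by rewrite mulr_algl mulr_algr. Qed.

Lemma nrm_sc_le r : 0 <= r -> nrm (sc r) <= r.
Proof.
by move=> r0; rewrite nrmZr ger0_norm // -[leRHS]mulr1 ler_wpM2l // nrm1_le.
Qed.

(** Working form of positivity: stability under sums can be proved for it directly, and it is
    identified with [positive] only in [positiveE]. *)
Definition psq a := exists h, star h = h /\ a = h * h.

Lemma psqZ (r : R) a : 0 <= r -> psq a -> psq (r%:C *: a).
Proof.
move=> r0 [h [sh ->]]; exists ((Num.sqrt r)%:C *: h); rewrite starZr sh; split=> //.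
by rewrite -scalerAl -scalerAr scalerA -rmorphM -(expr2 (Num.sqrt r)) sqr_sqrtr.
Qed.

Lemma psq0 : psq 0.
Proof. by exists 0; rewrite star0 mulr0. Qed.

(** This is [sqrt_1sub] for [k / r], rescaled; a second use of it, on [1 - c], makes the root itself
    a square. The case [r = 0] forces [k = 0]. *)
Lemma sqrt_sub k (r : R) : star k = k -> nrm k <= r ->
  exists c, [/\ star c = c, c * c = sc r - k, bicomm k c & psq c].
Proof.
move=> sk kr; have r0 : 0 <= r := le_trans (nge0 k) kr.
have [r_eq0|rN0] := eqVneq r 0.
  have k0 : k = 0 by apply: nrm0_eq0; apply/eqP; rewrite eq_le nge0 -{1}r_eq0 kr.
  exists 0; split; rewrite ?star0 //; [|by move=> b _; rewrite mulr0 mul0r|exact: psq0].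
  by rewrite k0 r_eq0 rmorph0 scale0r mulr0 subr0.
have [||c [sc cc hc c1]] := @sqrt_1sub ((r^-1)%:C *: k).
- by rewrite starZr sk.
- by rewrite nrmZr ger0_norm ?invr_ge0 // mulrC ler_pdivrMr ?mul1r // lt_def rN0.
exists ((Num.sqrt r)%:C *: c); split.
- by rewrite starZr sc.
- rewrite -scalerAl -scalerAr scalerA cc -rmorphM -expr2 sqr_sqrtr // scalerBr scalerA.
  by rewrite -rmorphM divff // rmorph1 scale1r.
- move=> b bk; rewrite -scalerAl -scalerAr hc //.
  by rewrite -scalerAl -scalerAr bk.
- apply: psqZ; first exact: sqrtr_ge0.
  have [|e [se ee _ _]] := sqrt_1sub _ c1; first by rewrite starB star1 sc.
  by exists e; rewrite ee subKr.
Qed.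

(* [e + i g] is [sqrt r] times a unitary *)
Lemma nrm_sq_le_of_sqD e g (r : R) : star e = e -> star g = g -> e * g = g * e ->
  0 <= r -> e * e + g * g = sc r -> nrm (e * e) <= r.
Proof.
move=> se sg eg r0 eqr; pose u := e + 'i%C *: g.
have su : star u = e - 'i%C *: g by rewrite starD starZi se sg.
have uu : star u * u = sc r.
  rewrite su mulrBl !mulrDr -!scalerAl -!scalerAr scale_ii eg.
  by rewrite opprD opprK addrA addrK.
have nu : nrm u ^+ 2 <= r by rewrite -nrmC uu nrm_sc_le.
have ne : nrm e <= nrm u.
  have : nrm (e + e) <= nrm u + nrm u.
    have -> : e + e = u + star u by rewrite su addrACA subrr addr0.
    by apply: le_trans (nrmD _ _) _; rewrite nrm_star.
  have -> : e + e = (2 : R)%:C *: e by rewrite -mulr2n rmorph_nat scaler_nat.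
  by rewrite nrmZr ger0_norm //; lra.
by rewrite nrm_sq //; apply: le_trans nu; rewrite ler_sqr ?nnegrE.
Qed.

(** The root [c] of [r - h * h] commutes with [h], and [c * c + h * h = r], so the unitary argument
    bounds [c * c]. *)
Lemma nrm_sub_sq h (r : R) : star h = h -> nrm (h * h) <= r -> nrm (sc r - h * h) <= r.
Proof.
move=> sh hr; have [|c [sc cc hc _]] := sqrt_sub _ hr; first by rewrite starM sh.
rewrite -cc; apply: (@nrm_sq_le_of_sqD c h) => //.
- by apply/esym/hc; rewrite mulrA.
- exact: le_trans (nge0 _) hr.
- by rewrite cc subrK.
Qed.

Lemma psq_star a : psq a -> star a = a.
Proof. by move=> [h [sh ->]]; rewrite starM sh. Qed.

Lemma psq_sub a (r : R) : star a = a -> nrm a <= r -> psq (sc r - a).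
Proof. by move=> sa /(sqrt_sub sa)[c [sc cc _ _]]; exists c. Qed.

Lemma nrm_sub_psq a (r : R) : psq a -> nrm a <= r -> nrm (sc r - a) <= r.
Proof. by move=> [h [sh ->]]; exact: nrm_sub_sq. Qed.

(** Writing [a] as [nrm a - (nrm a - a)] puts it in the scope of [sqrt_sub]. The gain over the
    definition of [psq] is a root that is positive and commutes with all that commutes with [a]. *)
Lemma psq_root a : psq a -> exists h, [/\ star h = h, h * h = a, bicomm a h & psq h].
Proof.
move=> pa; have sa := psq_star pa.
have [|h [sh hh hc]] := sqrt_sub _ (nrm_sub_psq pa (lexx _)).
  by rewrite starB star_sc sa.
exists h; split=> //; first by rewrite hh opprB addrC subrK.
by move=> b ba; apply: hc; rewrite mulrBl mulrBr ba sc_comm.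
Qed.

(** Positivity of a self-adjoint [a] is read off from [nrm (r - a) <= r], a condition that adds up
    by the triangle inequality. *)
Lemma psqD a b : psq a -> psq b -> psq (a + b).
Proof.
move=> pa pb; have sa := psq_star pa; have sb := psq_star pb.
have -> : a + b = sc (nrm a + nrm b) - (sc (nrm a) - a + (sc (nrm b) - b)).
  by rewrite scD opprD !opprB addrACA !subrKC.
apply: psq_sub; first by rewrite starD !starB !star_sc sa sb.
by apply: le_trans (nrmD _ _) _; apply: lerD; exact: nrm_sub_psq.
Qed.

Lemma psqM a b : psq a -> psq b -> a * b = b * a -> psq (a * b).
Proof.
move=> /psq_root[h [sh <- hc _]] /psq_root[k [sk <- kc _]] ab.
have hk : h * k = k * h by apply/esym/hc/esym/kc.
exists (h * k); split; first by rewrite starM sh sk.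
by rewrite -!mulrA; congr (_ * _); rewrite !mulrA hk.
Qed.

Lemma nrm_le_of_psq_sub a (r : R) : 0 <= r -> psq a -> psq (sc r - a) -> nrm a <= r.
Proof.
move=> r0 [e [se ->]] /psq_root[g [sg gg gc _]].
apply: (@nrm_sq_le_of_sqD e g) => //; last by rewrite gg addrC subrK.
by apply: gc; rewrite mulrBl mulrBr mulrA sc_comm.
Qed.

Lemma nrm_le_psqD a b : psq a -> psq b -> nrm a <= nrm (a + b).
Proof.
move=> pa pb; apply: nrm_le_of_psq_sub => //.
have -> : sc (nrm (a + b)) - a = sc (nrm (a + b)) - (a + b) + b.
  by rewrite opprD addrA subrK.
apply: psqD => //; apply: psq_sub => //; exact/psq_star/psqD.
Qed.

Lemma psq_opp_eq0 a : psq a -> psq (- a) -> a = 0.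
Proof.
move=> pa pNa; have := nrm_le_psqD pa pNa; rewrite subrr nrm0 => h.
by apply: nrm0_eq0; apply/eqP; rewrite eq_le h nge0.
Qed.

(** * Negative parts, and positivity of [star x * x] *)

Lemma abs_root a : star a = a ->
  exists n, [/\ star n = n, a * n = n * a & (n * n) * (n * n) = a * a].
Proof.
move=> sa; have [|m [_ mm mc]] := @psq_root (a * a); first by exists a.
move=> /psq_root[n [sn nn nc _]]; exists n; rewrite nn; split=> //.
by apply/nc/mc; rewrite mulrA.
Qed.

(* [n ^ 2 = |a|], so that [y] is twice the negative part of [a] *)
Lemma neg_part a : star a = a -> exists n y,
  [/\ star n = n, star y = y, y = n * n - a, n * y = y * n /\ y * y = n * (n * y) + n * (n * y) &
      y * a * y = - (n * y * (n * y))].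
Proof.
move=> /[dup] sa /abs_root[n [sn an nn]]; pose y := n * n - a.
have sy : star y = y by rewrite starB starM sn sa.
have ny : n * y = y * n by rewrite mulrBl mulrBr an mulrA.
have ay : a * y = - (n * n * y).
  by rewrite !mulrBr nn opprB mulrA an -mulrA an mulrA.
exists n, y; split=> //.
- by split=> //; rewrite {1}/y mulrBl ay opprK -mulrA.
- by rewrite -mulrA ay mulrN !mulrA -ny.
Qed.

(* [w] intertwines functions of [star w * w] and of [w * star w]; the function [r - t] is
   bounded by [r] on the spectrum of the latter, but not on that of the former. *)
Lemma star_mul_npsq w : psq (- (star w * w)) -> psq (w * star w) -> w = 0.
Proof.
set z := - (star w * w) => pz pw; have sz := psq_star pz.
set r := nrm w ^+ 2; have r0 : 0 <= r by exact: sqr_ge0.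
have nz : nrm z = r by rewrite nrmN nrmC.
have nw : nrm (w * star w) = r by rewrite -{1}(starK w) nrmC nrm_star.
have e1 : w * (sc r + z) = (sc r - w * star w) * w.
  by rewrite mulrDr mulrBl sc_comm mulrN mulrA.
have h1 : nrm (w * (sc r + z)) <= r * nrm w.
  rewrite e1; apply: le_trans (nrmM _ _) _; rewrite ler_wpM2r //.
  by apply: nrm_sub_psq; rewrite ?nw.
have h2 : nrm (w * (sc r + z)) ^+ 2 <= r ^+ 2 * r.
  by rewrite {2}/r -exprMn ler_sqr ?nnegrE // mulr_ge0.
rewrite -nrmC starM starD star_sc sz in h2.
(* Since [star w * w = - z], the product is minus a sum of positive terms, one of them [2 r z^2]. *)
have e2 : (sc r + z) * star w * (w * (sc r + z)) =
    - ((r + r)%:C *: (z * z) + (r%:C *: (r%:C *: z) + z * z * z)).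
  rewrite mulrA -(mulrA (sc r + z)) -[star w * w]opprK -/z mulrN mulNr; congr (- _).
  rewrite mulrDr mulr_algr mulrDl mulr_algl scalerDr mulrDl -scalerAl.
  by rewrite rmorphD scalerDl [_ + r%:C *: (z * z)]addrC addrACA.
have pzz : psq (z * z) by exists z.
have pA : psq ((r + r)%:C *: (z * z)) by apply: psqZ => //; rewrite addr_ge0.
have pB : psq (r%:C *: (r%:C *: z) + z * z * z).
  by apply: psqD; [do 2!apply: psqZ => // | apply: psqM => //; rewrite mulrA].
rewrite e2 nrmN in h2; have := le_trans (nrm_le_psqD pA pB) h2.
(* The term [2 r z^2] alone has norm [2 r^3], while the whole has norm at most [r^3]. *)
rewrite nrmZr ger0_norm ?addr_ge0 // nrm_sq // nz => h3.
have {h3} : r ^+ 3 <= 0 by move: h3; rewrite !expr2 !exprS expr0; nra.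
move=> h3; apply: nrm0_eq0; apply/eqP.
have : r ^+ 3 == 0 by rewrite eq_le h3 exprn_ge0.
by rewrite expf_eq0 /= sqrf_eq0.
Qed.

(** With [y] twice the negative part of [star x * x] and [w = x * y], the element [- (star w * w)]
    is a square. Then so is [w * star w], and [star_mul_npsq] gives [w = 0], whence [y = 0]. *)
Lemma psq_starM x : psq (star x * x).
Proof.
have sa : star (star x * x) = star x * x by rewrite starM starK.
have [n [y [sn sy ya [ny yy] yay]]] := neg_part sa.
pose w := x * y; pose v := star w.
have vw : - (v * w) = n * y * (n * y).
  by rewrite /v /w starM sy mulrA -(mulrA y) yay opprK.
have pvw : psq (- (v * w)).
  by rewrite vw; exists (n * y); rewrite starM sn sy -ny.
suff w0 : w = 0.
  have ny0 : n * y = 0.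
    by apply: sa_sq_eq0; rewrite ?starM ?sn ?sy -?ny // -vw w0 mulr0 oppr0.
  have y0 : y = 0 by apply: sa_sq_eq0 => //; rewrite yy ny0 mulr0 addr0.
  by exists n; split=> //; apply/esym/eqP; rewrite -subr_eq0 -ya y0.
apply: star_mul_npsq => //; rewrite -/v.
(* Up to scalars, [w + v] and [k] are the real and imaginary parts of [w]; their squares add up to
   twice [w * v + v * w], which isolates [w * v] as a sum of positive elements. *)
pose k := 'i%C *: (w - v).
have sk : star k = k by rewrite /k starZi starB starK -/v -scalerN opprB.
have sp : star (w + v) = w + v by rewrite starD starK addrC.
have kk : (w + v) * (w + v) + k * k = (w * v + v * w) + (w * v + v * w).
  rewrite /k -scalerAl -scalerAr scale_ii.
  have -> : (w + v) * (w + v) = (w + v) * (w - v) + (w + v) * (v + v).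
    by rewrite -mulrDr addrA subrK.
  have -> : (w - v) * (w - v) = (w + v) * (w - v) - (v + v) * (w - v).
    by rewrite -mulrBl opprD addrA addrK.
  have DE : v * (w - v) + (w + v) * v = w * v + v * w.
    by rewrite mulrBr mulrDl [w * v + v * v]addrC subrKA addrC.
  rewrite opprB addrCA [X in _ + (X - _)]addrC addrK.
  rewrite [(v + v) * _]mulrDl [(w + v) * _]mulrDr addrACA.
  by rewrite DE.
have -> : w * v = (2^-1 : R)%:C *: ((w + v) * (w + v) + k * k) - v * w.
  by rewrite kk half_double addrK.
apply: psqD => //; apply: psqZ; first by rewrite invr_ge0.
by apply: psqD; [exists (w + v) | exists k].
Qed.

(** * Order consequences: corners and decompositions into positive elements *)

Lemma positiveE a : positive star a <-> psq a.
Proof.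
split=> [[b ->]|[h [sh ->]]]; first exact: psq_starM.
by exists h; rewrite sh.
Qed.

Lemma positive_star a : positive star a -> star a = a.
Proof. by move/positiveE/psq_star. Qed.

Lemma starM_add_eq0 x y : star x * x + star y * y = 0 -> x = 0.
Proof.
move=> /eqP; rewrite addr_eq0 => /eqP xy; apply: cstar_eq0; apply: psq_opp_eq0.
  exact: psq_starM.
by rewrite xy opprK; exact: psq_starM.
Qed.

(** For [p = 1 - q], the positive elements [p * a * p] and [p * (b - a) * p] sum to [p * b * p = 0].
    Both vanish, so [e * p = 0] for [a = star e * e]. *)
Lemma positive_corner q a b : q * q = q -> star q = q ->
  positive star a -> positive star (b - a) -> q * b * q = b -> q * a * q = a.
Proof.
move=> qq sq pa [c ec] qb; have sa := positive_star pa; case: pa => e ea.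
pose p := 1 - q; have sp : star p = p by rewrite starB star1 sq.
have bp : b * p = 0 by rewrite -qb /p mulrBr mulr1 -(mulrA _ q q) qq subrr.
have ep : e * p = 0.
  apply: (@starM_add_eq0 _ (c * p)).
  rewrite !starM sp !mulrA -!(mulrA p) -ea -ec -mulrDr -mulrDl subrKC.
  by rewrite bp mulr0.
have aq : a * q = a.
  by apply/esym/eqP; rewrite -subr_eq0 -{1}(mulr1 a) -mulrBr ea -mulrA ep mulr0.
by rewrite -mulrA aq -{1}sa -sq -starM aq.
Qed.

Lemma cartesian a : exists h k, [/\ star h = h, star k = k, a = h + 'i%C *: k,
  nrm h <= nrm a & nrm k <= nrm a].
Proof.
pose h := (2^-1 : R)%:C *: (a + star a).
pose k := (2^-1 : R)%:C *: ('i%C *: (star a - a)).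
have n2 x : nrm x <= nrm a + nrm a -> nrm ((2^-1 : R)%:C *: x) <= nrm a.
  by rewrite nrmZr ger0_norm ?invr_ge0 //; lra.
exists h, k; split.
- by rewrite starZr starD starK addrC.
- by rewrite starZr starZi starB starK -scalerN opprB.
- rewrite /h /k scalerA mulrC -scalerA scale_ii -scalerDr opprB addrACA subrr addr0.
  by rewrite half_double.
- by apply: n2; apply: le_trans (nrmD _ _) _; rewrite nrm_star.
- by apply: n2; rewrite nrmZi; apply: le_trans (nrm_sub _ _) _; rewrite nrm_star.
Qed.

Lemma sa_pos_decomp h : star h = h ->
  exists2 p, positive star p & h = sc (nrm h) - p.
Proof.
move=> sh; exists (sc (nrm h) - h); last by rewrite subKr.
by apply/positiveE/psq_sub.
Qed.

Lemma positive_sc r : 0 <= r -> positive star (sc r).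
Proof.
by move=> r0; apply/positiveE/psqZ => //; exists 1; rewrite star1 mulr1.
Qed.

(** * Positive linear maps preserve adjoints and are bounded *)

Section LinearMap.
Variable f : A -> A.
Hypothesis hf : is_linear f.

Lemma linear0 : f 0 = 0.
Proof. by rewrite -(scale0r (0 : A)) (proj2 hf) !scale0r. Qed.

Lemma linearN a : f (- a) = - f a.
Proof. by rewrite -scaleN1r (proj2 hf) scaleN1r. Qed.

Lemma linearB a b : f (a - b) = f a - f b.
Proof. by rewrite (proj1 hf) linearN. Qed.

Lemma linear_bounded_continuous (C : R) : (forall a, nrm (f a) <= C * nrm a) ->
  ncontinuous nrm f.
Proof.
move=> hC x e e0; have C0 : 0 < `|C| + 1 by have := normr_ge0 C; lra.
exists (e / (`|C| + 1)); first by rewrite divr_gt0.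
move=> y; rewrite ltr_pdivlMr // -linearB; apply: le_lt_trans.
apply: le_trans (hC _) _; rewrite mulrC; apply: ler_wpM2l => //.
by have := ler_norm C; lra.
Qed.

Hypothesis fpos : forall a, positive star a -> positive star (f a).

Lemma positive_map_star a : f (star a) = star (f a).
Proof.
have sa h : star h = h -> star (f h) = f h.
  move=> /sa_pos_decomp[p pp ->]; rewrite linearB starB; congr (_ - _).
  - exact/positive_star/fpos/positive_sc.
  - exact/positive_star/fpos.
have [h [k [sh sk -> _ _]]] := cartesian a.
rewrite starD starZi sh sk (proj1 hf) linearN !(proj2 hf) (proj1 hf) (proj2 hf).
by rewrite starD starZi !sa.
Qed.

(** For self-adjoint [h], both [nrm h - f h] and [nrm h + f h] are positive and commute; their
    product bounds [f h * f h] by [nrm h ^+ 2]. The factor 2 comes from adding the two Cartesian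
    parts. *)
Lemma positive_map_bound a : psq (1 - f 1) -> nrm (f a) <= 2 * nrm a.
Proof.
move=> p1.
have half h : star h = h -> psq (sc (nrm h) - f h).
  move=> sh; have -> : sc (nrm h) - f h =
      (nrm h)%:C *: (1 - f 1) + f (sc (nrm h) - h).
    by rewrite linearB (proj2 hf) scalerBr subrKA.
  by apply: psqD; [exact: psqZ | apply/positiveE/fpos/positiveE/psq_sub].
have sa h : star h = h -> nrm (f h) <= nrm h.
  move=> sh; have sf : star (f h) = f h by rewrite -positive_map_star sh.
  have pm := half h sh; have := half (- h).
  rewrite starN sh nrmN linearN opprK => /(_ erefl) pp.
  rewrite -ler_sqr ?nnegrE // -nrm_sq //.
  apply: nrm_le_of_psq_sub; [exact: sqr_ge0 | by exists (f h) |].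
  have -> : sc (nrm h ^+ 2) - f h * f h = (sc (nrm h) - f h) * (sc (nrm h) + f h).
    by rewrite mulrDr !mulrBl (sc_comm _ (f h)) addrA subrK mulr_algl scalerA expr2 rmorphM.
  apply: psqM => //.
  by rewrite mulrBl mulrBr !mulrDl !mulrDr (sc_comm _ (f h)).
have [h [k [sh sk ea nh nk]]] := cartesian a.
rewrite {1}ea (proj1 hf) (proj2 hf); apply: le_trans (nrmD _ _) _; rewrite nrmZi.
by have := sa _ sh; have := sa _ sk; lra.
Qed.

End LinearMap.

(** * Transfer operators of a star-endomorphism *)

Section Endomorphism.
Variable d : A -> A.
Hypothesis hd : star_endo star d.

Let dlin : is_linear d. Proof. by case: hd. Qed.
Let dM a b : d (a * b) = d a * d b. Proof. by case: hd. Qed.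
Let dS a : d (star a) = star (d a). Proof. by case: hd. Qed.

Let q11 : d 1 * d 1 = d 1. Proof. by rewrite -dM mulr1. Qed.
Let sq1 : star (d 1) = d 1. Proof. by rewrite -dS star1. Qed.
Let q1l a : d 1 * d a = d a. Proof. by rewrite -dM mul1r. Qed.
Let q1r a : d a * d 1 = d a. Proof. by rewrite -dM mulr1. Qed.

Lemma range_in_corner x : in_range d x -> d 1 * x * d 1 = x.
Proof. by move=> [a ->]; rewrite q1l q1r. Qed.

Section Transfer.
Variable T : A -> A.
Hypothesis hT : transfer_operator star nrm d T.

Let Tlin : is_linear T. Proof. by case: hT. Qed.
Let Tpos a : positive star a -> positive star (T a). Proof. by case: hT => _ _ + _; apply. Qed.
Let TS a : T (star a) = star (T a). Proof. exact: positive_map_star. Qed.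

Lemma transfer_left a b : T (d a * b) = a * T b.
Proof. by case: hT. Qed.

Lemma transfer_right a b : T (b * d a) = T b * a.
Proof.
by rewrite -(starK (b * d a)) TS starM -dS transfer_left TS starM !starK.
Qed.

Lemma transfer_range a : T (d a) = a * T 1.
Proof. by rewrite -transfer_left mulr1. Qed.

Lemma transfer_corner a : T (d 1 * a * d 1) = T a.
Proof. by rewrite transfer_right mulr1 transfer_left mul1r. Qed.

End Transfer.

(** Computing [T (d a)] from the left and from the right shows that [T 1] is central. On [T 1 * A]
    the map [T] is a left inverse of [d], which gives injectivity there. *)
Lemma nondegenerate_cond3i T : nondegenerate_transfer star nrm d T -> cond3i star d (T 1).
Proof.
move=> [hT dT1]; have cT a : T 1 * a = a * T 1.
  by rewrite -transfer_range // -[d a]mul1r transfer_right.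
split=> //.
- split=> //; first by rewrite -transfer_range // dT1 transfer_range // mul1r.
  by apply: positive_star; case: hT => _ _ + _; apply; exists 1; rewrite star1 mulr1.
- have red a : T (d (T 1 * a)) = T 1 * a.
    by rewrite dM dT1 q1l transfer_range // cT.
  split=> [_ _ [a ->] [b ->] h|a]; first by rewrite -red h red.
  by exists (T 1 * a); [exists a | rewrite dM dT1 q1l].
Qed.

Lemma complete_nondegenerate T :
  complete_transfer star nrm d T -> nondegenerate_transfer star nrm d T.
Proof. by move=> [hT dT]; split=> //; rewrite dT mulr1 q11. Qed.

Lemma complete_range_corner T : complete_transfer star nrm d T -> range_corner d.
Proof.
move=> [_ dT] x; split=> [/range_in_corner h|[a ->]]; first by exists x.
by exists (T a).
Qed.

(** [T] sees only the compression of [a] to the corner, which is some [d b], and non-degeneracy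
    gives [d (T (d b)) = d b]. *)
Lemma range_corner_complete T : range_corner d ->
  nondegenerate_transfer star nrm d T -> complete_transfer star nrm d T.
Proof.
move=> rc [hT dT1]; split=> // a; rewrite -(transfer_corner hT).
have [|b ->] := proj2 (rc (d 1 * a * d 1)); first by exists a.
by rewrite transfer_range // dM dT1 q1r.
Qed.

(** * Hereditary range versus range equal to the corner *)

Lemma range_corner_hereditary : range_corner d ->
  hereditary_subalgebra star nrm (in_range d).
Proof.
move=> rc; have inr x : d 1 * x * d 1 = x -> in_range d x.
  by move=> h; apply/rc; exists x.
split; first split.
- by exists 0; rewrite linear0.
- by move=> _ _ [a ->] [b ->]; exists (a + b); rewrite (proj1 dlin).
- by move=> c _ [a ->]; exists (c *: a); rewrite (proj2 dlin).
- by move=> _ _ [a ->] [b ->]; exists (a * b); rewrite dM.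
- by move=> _ [a ->]; exists (star a); rewrite dS.
split.
(* The range is the fixed-point set of the continuous compression by [d 1], hence closed. *)
- move=> u l hu ul; apply: inr; apply: (nlim_unique _ ul).
  have := nlimMr (d 1) (nlimMl (d 1) ul).
  by under eq_fun do rewrite range_in_corner //.
- move=> a b pa pba /range_in_corner qb; apply: inr.
  exact: (positive_corner q11 sq1 pa pba qb).
Qed.

Lemma hereditary_range_corner : hereditary_subalgebra star nrm (in_range d) ->
  range_corner d.
Proof.
move=> [[_ SD SZ _ _] [_ Sher]] x; split=> [/range_in_corner h|[{}x ->]]; first by exists x.
pose c a := d 1 * a * d 1.
have cD a b : c (a + b) = c a + c b by rewrite /c mulrDr mulrDl.
have cB a b : c (a - b) = c a - c b by rewrite /c mulrBr mulrBl.
have cZ k a : c (k *: a) = k *: c a by rewrite /c -scalerAr -scalerAl.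
have csc r : in_range d (c (sc r)).
  by exists (sc r); rewrite cZ /c mulr1 q11 (proj2 dlin).
have cpos a : positive star a -> positive star (c a).
  by move=> [b ->]; exists (b * d 1); rewrite starM sq1 /c !mulrA.
have csa h : star h = h -> in_range d (c h).
  move=> sh; have [p pp ->] := sa_pos_decomp sh.
  (* [c h] is [c] of a scalar minus [c p]; the former is the image of a scalar, and [c p] lies below
     [c (sc (nrm p))], which is in the range too. *)
  rewrite cB -scaleN1r; apply: SD => //; apply: SZ.
  apply: (Sher _ (c (sc (nrm p)))) => //; first exact: cpos.
  by rewrite -cB; apply/cpos/positiveE/psq_sub => //; exact: positive_star.
have [h [k [sh sk -> _ _]]] := cartesian x.
by rewrite -/(c _) cD cZ; apply: SD; [|apply: SZ]; exact: csa.
Qed.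

(** * From the central projection to a complete transfer operator *)

Lemma cond3_complete P : cond3i star d P -> range_corner d ->
  exists T, complete_transfer star nrm d T.
Proof.
move=> [[PP sP cP] dP [inj sur]] rc.
have Px x : in_corner P x -> P * x = x by move=> [a ->]; rewrite mulrA PP.
have inP x : P * x = x -> in_corner P x by move=> h; exists x.
have [T hT] : {T : A -> A & forall a, in_corner P (T a) /\ d (T a) = d 1 * a * d 1}.
  apply: (@boolp.choice _ _ (fun a x => in_corner P x /\ d x = d 1 * a * d 1)) => a.
  have [|b qb] := proj2 (rc (d 1 * a * d 1)); first by exists a.
  by have [x Pxx dx] := sur b; exists x; rewrite dx.
have PT a : P * T a = T a by case: (hT a) => /Px.
have dT a : d (T a) = d 1 * a * d 1 by case: (hT a).
(* Injectivity of [d] on [P A] characterises [T a]; linearity, self-adjointness of [T (star b * b)]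
   and the transfer identity are all verified through it. *)
have Tuniq a x : P * x = x -> d x = d 1 * a * d 1 -> T a = x.
  by move=> hx dx; apply: inj; rewrite ?dT //; apply: inP.
have Tlin : is_linear T.
  split=> [a b|k a]; apply: Tuniq; rewrite ?mulrDr -?scalerAr ?PT //.
    by rewrite (proj1 dlin) !dT mulrDl.
  by rewrite (proj2 dlin) dT scalerAl.
have T1 : T 1 = P by apply: Tuniq; rewrite // mulr1 q11.
have Tpos a : positive star a -> positive star (T a).
  move=> [b ->]; set x := T _.
  have Pxx : P * x = x by exact: PT.
  have sx : star x = x.
    apply/esym/Tuniq; first by rewrite -{1}sP -starM -cP Pxx.
    by rewrite dS dT !starM starK sq1 !mulrA.
  have [n [y [sn sy ey [ny yy] yxy]]] := neg_part sx.
  (* [y * x * y = - (n * y) * (n * y)], while [d (y * x * y)] is of the form [star z * z]; two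
     positive elements summing to 0 both vanish. *)
  have dny : d (n * y) = 0.
    apply: (@starM_add_eq0 _ (b * d 1 * d y)).
    rewrite -dS !starM sq1 -dS sn sy -ny -dM.
    have -> : d y * (d 1 * star b) * (b * d 1 * d y) = d (y * x * y).
      by rewrite !dM dT !mulrA.
    by rewrite yxy linearN // subrr.
  have Pny : P * (n * y) = 0.
    apply: inj; [by exists (n * y) | by exists 0; rewrite mulr0 |].
    by rewrite dM dny mulr0 linear0.
  have Py : P * y = 0.
    apply: sa_sq_eq0; first by rewrite starM sy sP cP.
    rewrite -mulrA (mulrA y P) -(cP y) -mulrA (mulrA P P) PP yy mulrDr.
    by rewrite (mulrA P n) (cP n) -mulrA Pny mulr0 addr0.
  (* As [P * y = 0], multiplying [y = n * n - x] by [P] gives [x = P * n * n], the square of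
     [P * n]. *)
  exists (P * n); rewrite starM sn sP -mulrA (mulrA P P) PP (cP n) mulrA -cP.
  by rewrite -Pxx; apply/eqP; rewrite -subr_eq0 -mulrBr -opprB -ey mulrN Py oppr0.
exists T; split=> //; split=> //.
(* Here [1 - T 1] is the projection [1 - P], its own square, so [positive_map_bound] applies. *)
- apply: (linear_bounded_continuous Tlin (C := 2)) => a.
  apply: positive_map_bound => //; exists (1 - P); rewrite starB star1 sP T1; split=> //.
  by rewrite mulrBr mulr1 mulrBl mul1r PP subrr subr0.
- move=> a b; apply: Tuniq; first by rewrite mulrA cP -mulrA PT.
  by rewrite dM dT !mulrA q1l q1r.
Qed.

(** * Uniqueness of the projection and of the operator *)

Lemma cond3i_unique P1 P2 : cond3i star d P1 -> cond3i star d P2 -> P1 = P2.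
Proof.
have le Q1 Q2 : cond3i star d Q1 -> cond3i star d Q2 -> Q1 * Q2 = Q1.
  move=> [[QQ _ _] dQ1 [inj _]] [_ dQ2 _]; apply: inj.
  - by exists Q2.
  - by exists Q1; rewrite QQ.
  - by rewrite dM dQ1 dQ2 q11.
move=> h1 h2; rewrite -(le _ _ h1 h2) -[RHS](le _ _ h2 h1).
by case: h1 => [[_ _ ->]].
Qed.

(** Completeness gives [T 1 * T a = T (d (T a)) = T (d 1 * a * d 1) = T a]. *)
Lemma complete_in_corner T a : complete_transfer star nrm d T -> in_corner (T 1) (T a).
Proof.
move=> [hT dT]; exists (T a); case: (nondegenerate_cond3i (complete_nondegenerate (conj hT dT))).
move=> [_ _ cT] _ _; rewrite cT -transfer_range // dT.
by rewrite transfer_corner.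
Qed.

(** By uniqueness of the projection [T1 1 = T2 1], so both values lie in one corner, where [d] is
    injective, and they have the same image. *)
Lemma complete_unique T1 T2 : complete_transfer star nrm d T1 ->
  complete_transfer star nrm d T2 -> forall a, T1 a = T2 a.
Proof.
move=> h1 h2 a.
have c1 := nondegenerate_cond3i (complete_nondegenerate h1).
have c2 := nondegenerate_cond3i (complete_nondegenerate h2).
have [_ _ [inj _]] := c1; apply: inj.
- exact: complete_in_corner.
- by rewrite (cond3i_unique c1 c2); exact: complete_in_corner.
- by rewrite (proj2 h1) (proj2 h2).
Qed.

End Endomorphism.
End CstarAlgebra.

Theorem theorem1 (R : realType) (A : algType R[i]) (star : A -> A) (nrm : A -> R)
  (hA : is_cstar star nrm) (d : A -> A) (hd : star_endo star d) :
  let cond1 := exists T, complete_transfer star nrm d T in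
  let cond2 := (exists T, nondegenerate_transfer star nrm d T) /\
               hereditary_subalgebra star nrm (in_range d) in
  let cond3 := (exists P, cond3i star d P) /\ range_corner d in
  [/\ (cond1 <-> cond2), (cond2 <-> cond3),
      (* uniqueness of the transfer operator in 1) and in 2), and they coincide *)
      (forall T1 T2,
         complete_transfer star nrm d T1 \/
           (nondegenerate_transfer star nrm d T1 /\ hereditary_subalgebra star nrm (in_range d)) ->
         complete_transfer star nrm d T2 \/
           (nondegenerate_transfer star nrm d T2 /\ hereditary_subalgebra star nrm (in_range d)) ->
         forall a, T1 a = T2 a),
      (* uniqueness of P in 3) *)
      (forall P1 P2, cond3i star d P1 -> cond3i star d P2 -> P1 = P2) &
      (* P = d_*(1) and d_*(a) = d^{-1}(d(1) a d(1)) *)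
      (forall T P, complete_transfer star nrm d T -> cond3i star d P ->
         P = T 1 /\
         (forall a, in_corner P (T a) /\ d (T a) = d 1 * a * d 1))].
Proof.
move=> cond1 cond2 cond3.
(* A hereditary range turns a non-degenerate operator into a complete one, so uniqueness in both
   cases reduces to [complete_unique]. *)
have complete T : complete_transfer star nrm d T \/
    (nondegenerate_transfer star nrm d T /\ hereditary_subalgebra star nrm (in_range d)) ->
    complete_transfer star nrm d T.
  by case=> // -[nT her]; exact/(range_corner_complete hA hd)/nT/(hereditary_range_corner hA hd).
have c12 : cond1 -> cond2.
  move=> [T cT]; split; first by exists T; exact: (complete_nondegenerate hd).
  exact/(range_corner_hereditary hA hd)/(complete_range_corner hd cT).
have c21 : cond2 -> cond1.
  by move=> [[T nT] her]; exists T; apply: complete; right.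
split=> //.
- split=> [/c21[T cT]|[[P cP] rc]]; last exact/c12/(cond3_complete hA hd cP rc).
  split; last exact: (complete_range_corner hd cT).
  exists (T 1); exact/(nondegenerate_cond3i hA hd)/(complete_nondegenerate hd).
- by move=> T1 T2 /complete h1 /complete h2; exact: (complete_unique hA hd).
- by move=> P1 P2; exact: (cond3i_unique hd).
- move=> T P cT cP.
  have PT : P = T 1.
    apply: (cond3i_unique hd cP).
    exact/(nondegenerate_cond3i hA hd)/(complete_nondegenerate hd).
  split=> // a; split; last by case: cT.
  by rewrite PT; exact: (complete_in_corner hA hd).
Qed.
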